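(* Let $n\geq 4$ be an integer and let $U=\{L(\alpha): \alpha=(\alpha_3,\alpha_4,\dots,\alpha_n,\theta)\in\mathbb{C}^{n-1},\ \alpha_3(\alpha_4+2\alpha_3^2)\neq 0\}$ (a set of $(n+1)$-dimensional complex filiform Leibniz algebras). (i) Two algebras $L(\alpha)$ and $L(\alpha')$ from $U$, with $\alpha=(\alpha_3,\dots,\alpha_n,\theta)$ and $\alpha'=(\alpha_3',\dots,\alpha_n',\theta')$, are isomorphic if and only if $$\rho_i\Big(\frac{2\alpha_3}{\alpha_4+2\alpha_3^2},\frac{\alpha_4}{2\alpha_3^2};\alpha\Big)=\rho_i\Big(\frac{2\alpha_3'}{\alpha_4'+2\alpha_3'^2},\frac{\alpha_4'}{2\alpha_3'^2};\alpha'\Big)\quad\text{for all } i=3,4,\dots,n-1.$$ (ii) For any $(a_3,a_4,\dots,a_{n-1})\in\mathbb{C}^{n-3}$ there is an algebra $L(\alpha)$ in $U$ such that $$\rho_i\Big(\frac{2\alpha_3}{\alpha_4+2\alpha_3^2},\frac{\alpha_4}{2\alpha_3^2};\alpha\Big)=a_i\quad\text{for all } i=3,4,\dots,n-1.$$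
   Context: All algebras are over $\mathbb{C}$. A Leibniz algebra is an algebra with bilinear product $[\cdot,\cdot]$ satisfying $[x,[y,z]]=[[x,y],z]-[[x,z],y]$. Isomorphism means isomorphism of algebras. For $\alpha=(\alpha_3,\alpha_4,\dots,\alpha_n,\theta)\in\mathbb{C}^{n-1}$, $L(\alpha)$ denotes the $(n+1)$-dimensional filiform Leibniz algebra with basis $e_0,e_1,\dots,e_n$ and products (all omitted products being zero) - $[e_0,e_0]=e_2$, - $[e_i,e_0]=e_{i+1}$ for $1\le i\le n-1$, - $[e_0,e_1]=\alpha_3e_3+\alpha_4e_4+\dots+\alpha_{n-1}e_{n-1}+\theta e_n$, - $[e_j,e_1]=\alpha_3e_{j+2}+\alpha_4e_{j+3}+\dots+\alpha_{n+1-j}e_n$ for $1\le j\le n-2$. Polynomials $\varphi_t(y;z)$, $3\le t\le n+1$, in $y$ and $z=(z_3,z_4,\dots,z_n,z_{n+1})$ are defined recursively as follows. For $3\le k<t\le n$ put $$S_{t,k}(y;z)=\sum_{j=1}^{k-1}\binom{k-1}{j}y^j\sum_{\substack{m_1,\dots,m_j\ge 3\\ m_1+\dots+m_j=t-k+2j}}z_{m_1}z_{m_2}\cdots z_{m_j}$$ (the inner sum is over ordered tuples of integers; an empty sum is $0$). Then $$\varphi_t(y;z)=(1+y)z_t-\sum_{k=3}^{t-1}S_{t,k}(y;z)\,\varphi_k(y;z)\quad(3\le t\le n),$$ $$\varphi_{n+1}(y;z)=z_{n+1}+y z_n-\sum_{k=3}^{n-1}S_{n,k}(y;z)\,\varphi_k(y;z).$$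 Finally $$\rho_t(x,y;z)=x^t\varphi_{t+2}(y;z)\ \ (1\le t\le n-2),\qquad \rho_{n-1}(x,y;z)=x^{n-2}\varphi_{n+1}(y;z),$$ and $\rho_i(x,y;\alpha)$ means evaluation at $z_t=\alpha_t$ for $3\le t\le n$ and $z_{n+1}=\theta$. *)

(* Defs.v *)
From mathcomp Require Import all_boot all_order all_algebra.
From mathcomp Require Import zify.

Set Implicit Arguments.
Unset Strict Implicit.
Unset Printing Implicit Defensive.

Import GRing.Theory.
Local Open Scope ring_scope.

(* Not necessarily associative, not necessarily unital. *)
Record algebra (K : fieldType) := Algebra {
  carrier :> lmodType K;
  bracket : carrier -> carrier -> carrier;
  bracket_bilinear : bilinear_for *:%R *:%R bracket
}.

Definition is_leibniz (K : fieldType) (A : algebra K) : Prop :=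
  forall x y z : A,
    bracket x (bracket y z) =
    bracket (bracket x y) z - bracket (bracket x z) y.

Definition isomorphic (K : fieldType) (A B : algebra K) : Prop :=
  exists f : {linear A -> B},
    bijective f /\ forall x y : A, f (bracket x y) = bracket (f x) (f y).

(* A sequence whose entries are numbered from 3: s = (s_3, s_4, ...). Only
   meant for t >= 3, because of the truncated subtraction. *)
Definition at3 (K : fieldType) (s : seq K) (t : nat) : K := nth 0 s (t - 3)%N.

Section Polynomials.
Variables (K : fieldType) (y : K) (z : nat -> K).

(* Polynomials in y and z are represented by their values at y and z.
   The tuples (m_1, ..., m_j) are finite functions; the bound on their values
   loses nothing, since each m_i is at most the prescribed sum. *)
Definition S_poly (t k : nat) : K :=
  \sum_(1 <= j < k) 'C(k.-1, j)%:R * y ^+ j *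
    \sum_(m : {ffun 'I_j -> 'I_(t - k + 2 * j).+1} |
            [forall i, 3 <= m i]%N && (\sum_i m i == t - k + 2 * j)%N)
       \prod_i z (m i).

(* The first argument is fuel; see phi_eq for the resulting recursion. *)
Fixpoint phi_rec (fuel t : nat) : K :=
  if fuel is f.+1 then
    (1 + y) * z t - \sum_(3 <= k < t) S_poly t k * phi_rec f k
  else 0.

Definition phi (t : nat) : K := phi_rec t.+1 t.

Lemma phi_rec_fuel f t : (t < f)%N -> phi_rec f t = phi t.
Proof.
rewrite /phi; have [b] := ubnP t.
elim: b t f => // b IH t [|f] // /ltnSE tb tf /=.
congr (_ - _); apply: eq_big_nat => k /andP[_ kt]; congr (_ * _).
by rewrite !(IH k) //; apply: leq_trans kt _.
Qed.

Lemma phi_eq t :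
  phi t = (1 + y) * z t - \sum_(3 <= k < t) S_poly t k * phi k.
Proof.
rewrite {1}/phi /=; congr (_ - _); apply: eq_big_nat => k /andP[_ kt].
by rewrite phi_rec_fuel.
Qed.

(* The polynomial with index n + 1 depends on n. *)
Definition phi_last (n : nat) : K :=
  z n.+1 + y * z n - \sum_(3 <= k < n) S_poly n k * phi k.

End Polynomials.

Definition rho (K : fieldType) (n i : nat) (x y : K) (z : nat -> K) : K :=
  if i == n.-1 then x ^+ (n - 2) * phi_last y z n else x ^+ i * phi y z i.+2.

Section LAlpha.
Variables (K : fieldType) (n : nat).

(* alpha = (alpha_3, ..., alpha_n, theta), so that theta = at3 alpha n.+1. *)
Variable alpha : (n.-1).-tuple K.

Definition e_ (i : nat) : 'rV[K]_n.+1 := \row_j (j == i :> nat)%:R.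

(* The product [e_i, e_j]. *)
Definition basis_bracket (i j : nat) : 'rV[K]_n.+1 :=
  match j with
  | 0 => if i == 0%N then e_ 2
         else if (i <= n - 1)%N then e_ i.+1 else 0
  | 1 => if i == 0%N then
           \sum_(3 <= t < n) at3 alpha t *: e_ t + at3 alpha n.+1 *: e_ n
         else if (i <= n - 2)%N then
           \sum_(3 <= t < n.+2 - i) at3 alpha t *: e_ (i + t - 1)
         else 0
  | _ => 0
  end.

Definition L_bracket (u v : 'rV[K]_n.+1) : 'rV[K]_n.+1 :=
  \sum_(i < n.+1) \sum_(j < n.+1) (u 0 i * v 0 j) *: basis_bracket i j.

Lemma L_bracket_bilinear : bilinear_for *:%R *:%R L_bracket.
Proof.
split=> w a u v /=; rewrite /L_bracket scaler_sumr -big_split;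
  apply: eq_bigr => i _; rewrite scaler_sumr -big_split;
  apply: eq_bigr => j _; rewrite !mxE /= scalerA -scalerDl.
  by rewrite mulrDl mulrA.
by rewrite mulrDr mulrCA.
Qed.

Definition L : algebra K := Algebra L_bracket_bilinear.

Definition in_U : bool :=
  at3 alpha 3 * (at3 alpha 4 + 2 * at3 alpha 3 ^+ 2) != 0.

Local Notation b := basis_bracket.
Let Rm (j : nat) (u : 'rV[K]_n.+1) := \sum_(i < n.+1) u 0 i *: b i j.

Let Rm_lin j a u v : Rm j (a *: u + v) = a *: Rm j u + Rm j v.
Proof.
rewrite /Rm scaler_sumr -big_split; apply: eq_bigr => i _.
by rewrite !mxE scalerDl scalerA.
Qed.

Let RmZ j a u : Rm j (a *: u) = a *: Rm j u.
Proof.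
by rewrite /Rm scaler_sumr; apply: eq_bigr => i _; rewrite mxE scalerA.
Qed.

Let RmD j u v : Rm j (u + v) = Rm j u + Rm j v.
Proof. by rewrite -[u]scale1r Rm_lin !scale1r. Qed.

Let Rm0 j : Rm j 0 = 0.
Proof. by rewrite -[0 in LHS](scale0r (0 : 'rV[K]_n.+1)) RmZ scale0r. Qed.

Let Rm_sum j I (r : seq I) P F :
  Rm j (\sum_(i <- r | P i) F i) = \sum_(i <- r | P i) Rm j (F i).
Proof. by apply: big_morph => [u v|]; rewrite ?RmD ?Rm0. Qed.

Let Rm_e j t : (t <= n)%N -> Rm j (e_ t) = b t j.
Proof.
move=> tn; rewrite /Rm (bigD1 (inord t)) //= mxE inordK // eqxx scale1r.
rewrite big1 ?addr0 // => i; rewrite -val_eqE /= inordK // => it.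
by rewrite mxE (negbTE it) scale0r.
Qed.

Lemma L_is_leibniz : (4 <= n)%N -> is_leibniz L.
Proof.
move=> n4.
have brE u v : L_bracket u v =
    v 0 (inord 0) *: Rm 0 u + v 0 (inord 1) *: Rm 1 u.
  rewrite /L_bracket /Rm exchange_big /=.
  have E j : \sum_(i < n.+1) (u 0 i * v 0 j) *: b i j = v 0 j *: Rm j u.
    rewrite /Rm scaler_sumr; apply: eq_bigr => i _.
    by rewrite scalerA mulrC.
  rewrite (eq_bigr _ (fun j _ => E j)) (bigD1 (inord 0)) //=.
  rewrite (bigD1 (inord 1)) /=; last by rewrite -val_eqE /= !inordK //; lia.
  rewrite big1 ?addr0; first by rewrite !inordK //; lia.
  move=> [[|[|j]] jn]; rewrite -!val_eqE /= !inordK //; try lia.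
  by rewrite /Rm big1 ?scaler0 // => i _; rewrite scaler0.
have e0 t (k : 'I_n.+1) : (k < t)%N -> e_ t 0 k = 0.
  by move=> kt; rewrite mxE (_ : (k == t :> nat) = false) //; lia.
have b0 i j (k : 'I_n.+1) : (k < 2)%N -> b i j 0 k = 0.
  move=> k2; case: j => [|[|j]] /=; last by rewrite mxE.
    case: eqP => i0; first by rewrite e0.
    case: ifP => _; last by rewrite mxE.
    by rewrite e0 //; lia.
  case: eqP => i0; [|case: ifP => _]; last by rewrite mxE.
    rewrite mxE summxE big_nat_cond big1 ?add0r; last first.
      by move=> t /andP[/andP[t3 tn] _]; rewrite mxE e0 ?mulr0 //; lia.
    by rewrite mxE e0 ?mulr0 //; lia.
  rewrite summxE big_nat_cond big1 // => t /andP[/andP[t3 tn] _].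
  by rewrite mxE e0 ?mulr0 //; lia.
have br0 u v (k : 'I_n.+1) : (k < 2)%N -> L_bracket u v 0 k = 0.
  move=> k2; rewrite /L_bracket summxE big1 // => i _; rewrite summxE big1 //.
  by move=> j _; rewrite mxE b0 ?mulr0.
have comm_b i : (i <= n)%N -> Rm 1 (b i 0) = Rm 0 (b i 1).
  move=> i_n /=; have [_|i0] := eqVneq i 0%N.
    rewrite Rm_e; last lia.
    rewrite RmD RmZ Rm_sum Rm_e //= (_ : (2 <= n - 2)%N = true); last lia.
    rewrite (_ : (n == 0)%N = false); last lia.
    rewrite (_ : (n <= n - 1)%N = false); last lia.
    rewrite scaler0 addr0 subSS subSS subn0; apply: eq_big_nat => t /andP[t3 tn].
    rewrite RmZ Rm_e; last lia.
    rewrite /= (_ : (t == 0)%N = false); last lia.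
    rewrite (_ : (t <= n - 1)%N = true); last lia.
    by rewrite (_ : (2 + t - 1)%N = t.+1); last lia.
  have [in1|in1] := leqP i (n - 1); last first.
    by rewrite Rm0 (_ : (i <= n - 2)%N = false) ?Rm0 //; lia.
  rewrite Rm_e; last lia.
  case: leqP => in2; last first.
    by rewrite Rm0 /= (_ : (i.+1 <= n - 2)%N = false) //; lia.
  rewrite Rm_sum (_ : n.+2 - i = (n.+1 - i).+1)%N; last lia.
  rewrite big_nat_recr /=; last lia.
  rewrite RmZ Rm_e; last lia.
  rewrite (_ : (i + (n.+1 - i) - 1)%N = n) /=; last lia.
  rewrite (_ : (n == 0)%N = false); last lia.
  rewrite (_ : (n <= n - 1)%N = false); last lia.
  rewrite scaler0 addr0.
  have E : \sum_(3 <= t < n.+1 - i) Rm 0 (at3 alpha t *: e_ (i + t - 1)) =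
           \sum_(3 <= t < n.+1 - i) at3 alpha t *: e_ (i.+1 + t - 1).
    apply: eq_big_nat => t /andP[t3 tn]; rewrite RmZ Rm_e; last lia.
    rewrite /= (_ : (i + t - 1 == 0)%N = false); last lia.
    rewrite (_ : (i + t - 1 <= n - 1)%N = true); last lia.
    by rewrite (_ : (i + t - 1).+1 = (i.+1 + t - 1)%N); last lia.
  rewrite E; case: leqP => in3; last by rewrite subSS.
  by rewrite big_geq //; lia.
have comm u : Rm 1 (Rm 0 u) = Rm 0 (Rm 1 u).
  rewrite {2}/Rm {3}/Rm !Rm_sum; apply: eq_bigr => i _.
  by rewrite !RmZ comm_b // -ltnS.
move=> x y z /=; rewrite brE !br0 ?inordK ?scale0r ?addr0; [|lia..].
apply/esym/eqP; rewrite subr_eq0; apply/eqP; rewrite !brE.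
rewrite !RmD !RmZ comm !scalerDr !scalerA [LHS]addrACA.
by congr (_ *: _ + _ *: _ + (_ *: _ + _ *: _)); exact: mulrC.
Qed.

End LAlpha.

Arguments L {K n}.
Arguments in_U {K n}.

(* Main.v *)
(* With f = e_0 - e_1, the algebra L(alpha) is K f + K[X]/X^n, where
   e_i = X^(i-1) for i >= 1.  Put P = sum_t alpha_t X^(t-1) and
   delta = theta - alpha_n.  Right multiplication by e_0 is multiplication by X
   and kills f; right multiplication by e_1 is multiplication by P and sends f
   to delta X^(n-1).  An isomorphism L(alpha') -> L(alpha) conjugates
   multiplication by X into multiplication by g = A X + B P and that by P' into
   (A + B) P, so it exists iff P'(g) = (A + B) P mod X^n and
   delta = A^(n-2) delta' for some A, B with A (A + B) <> 0.  Comparing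
   coefficients, this says alpha' = rho(1/A, B/A; alpha).  The values of x and y
   in the theorem are those for which alpha' starts with 1, 0; two
   isomorphic algebras both starting with 1, 0 have A = 1 and B = 0, hence
   coincide. *)

Require Import Defs.
From HB Require Import structures.
From mathcomp Require Import all_boot all_order all_algebra.
From mathcomp Require Import reals complex zify ring.

Set Implicit Arguments.
Unset Strict Implicit.
Unset Printing Implicit Defensive.

Import GRing.Theory.
Local Open Scope ring_scope.

(** * Polynomials modulo a power of X *)

Section PolynomialsModXn.
Variable K : fieldType.
Implicit Types (p q g : {poly K}) (n i : nat).

Lemma dvdXnP n p : reflect (forall i, (i < n)%N -> p`_i = 0) ('X^n %| p).
Proof.
apply: (iffP (dvdpP _ _)) => [[q ->] i lin|p0]; first by rewrite coefMXn lin.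
exists (drop_poly n p); rewrite -[LHS](poly_take_drop n).
rewrite (_ : take_poly n p = 0) ?add0r //; apply/polyP=> i.
by rewrite coef_take_poly coef0; case: ifP => // /p0.
Qed.

Lemma coprimep_Xn n p : p`_0 != 0 -> coprimep 'X^n p.
Proof.
by move=> p0; rewrite coprimep_expl // coprimep_sym coprimepX /root horner_coef0.
Qed.

Lemma dvdX_coef0 p : ('X %| p) = (p`_0 == 0).
Proof.
by rewrite -['X]expr1; apply/dvdXnP/eqP => [->|p0 [|i]].
Qed.

Lemma coef0_comp_poly p g : g`_0 = 0 -> (p \Po g)`_0 = p`_0.
Proof. by move=> g0; rewrite -!horner_coef0 horner_comp !horner_coef0 g0 -horner_coef0. Qed.

Lemma dvdXn_exp g n : g`_0 = 0 -> 'X^n %| g ^+ n.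
Proof. by move=> g0; rewrite dvdp_exp2r // dvdX_coef0 g0. Qed.

Lemma dvdXn_comp p g n : g`_0 = 0 -> 'X^n %| p -> 'X^n %| p \Po g.
Proof.
move=> g0 /dvdpP[q ->]; rewrite comp_polyM comp_Xn_poly dvdp_mull //.
exact: dvdXn_exp.
Qed.

(** Write g = X h with h(0) nonzero. Each factor X of p becomes X h in p(g), and h can be cancelled,
    being coprime to X^n. *)
Lemma dvdXn_comp_inv p g n :
  g`_0 = 0 -> g`_1 != 0 -> 'X^n %| p \Po g -> 'X^n %| p.
Proof.
move=> g0 g1; elim: n p => [|n IHn] p; first by rewrite !dvd1p.
have /dvdpP[h gE] : 'X %| g by rewrite dvdX_coef0 g0.
have h0 : h`_0 != 0 by move: g1; rewrite gE coefMX.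
move=> dvd_pg; have : 'X %| p.
  rewrite dvdX_coef0 -(coef0_comp_poly p g0).
  by move/dvdXnP: dvd_pg => ->.
case/dvdpP=> q pE; move: dvd_pg; rewrite pE comp_polyM comp_polyX {2}gE mulrA.
rewrite exprSr !dvdp_mul2r ?polyX_eq0 // Gauss_dvdpl ?coprimep_Xn //.
exact: IHn.
Qed.

End PolynomialsModXn.

(** If g = X h, then h^m and its value at 0 agree modulo X. This isolates the coefficient of X^(n-1)
    in g^(n-1), which is where delta enters. *)
Lemma dvdXn_lead_exp (K : fieldType) (g : {poly K}) m :
  g`_0 = 0 -> 'X^(m.+1) %| g ^+ m - (g`_1 ^+ m) *: 'X^m.
Proof.
move=> g0; have /dvdpP[h gE] : 'X %| g by rewrite dvdX_coef0 g0.
rewrite gE coefMX exprMn -mul_polyC -mulrBl exprS dvdp_mul // dvdX_coef0.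
by rewrite coefB coefC /= -!horner_coef0 horner_exp subrr.
Qed.

(** * The polynomials phi as coefficients of a composition *)

Section Coefficients.
Variables (K : fieldType) (z : nat -> K).

(** This is the inner sum of S_{t,k}, with d = t - k. Taking the term of degree m_i - 2 from the
    i-th factor, the degrees add up to d exactly when the m_i add up to d + 2j. *)
Lemma coef_expr_tuples (q : {poly K}) (d j : nat) :
  (0 < j)%N ->
  (forall i, (i <= d)%N -> q`_i = if (0 < i)%N then z i.+2 else 0) ->
  (q ^+ j)`_d =
  \sum_(m : {ffun 'I_j -> 'I_(d + 2 * j).+1} |
          [forall i, 3 <= m i]%N && (\sum_i m i == d + 2 * j)%N)
     \prod_i z (m i).
Proof.
move=> j0 qE; set s := (d + 2 * j)%N.
(* [qs] agrees with q up to degree d and is indexed like the values of the finite functions, so its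
   j-th power distributes into the required sum. *)
pose qs : {poly K} := \sum_(m < s.+1 | (3 <= m)%N) z m *: 'X^(m - 2).
have qsE : 'X^(d.+1) %| q - qs.
  apply/dvdXnP=> i /ltnSE lid; rewrite coefB qE // coef_sum.
  case: posnP => [->|i0].
    rewrite big1 ?subrr // => m m3; rewrite coefZ coefXn.
    by rewrite (_ : (0 == m - 2)%N = false) ?mulr0 //; lia.
  have lt_i : (i.+2 < s.+1)%N by rewrite /s; lia.
  rewrite (bigD1 (Ordinal lt_i)) //= coefZ coefXn subn2 eqxx mulr1.
  rewrite big1 ?addr0 ?subrr // => m /andP[m3]; rewrite -val_eqE /= => mi.
  by rewrite coefZ coefXn (_ : (i == m - 2)%N = false) ?mulr0 //; lia.
have -> : (q ^+ j)`_d = (qs ^+ j)`_d.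
  apply/eqP; rewrite -subr_eq0 -coefB; apply/eqP.
  have /dvdXnP -> // : 'X^(d.+1) %| q ^+ j - qs ^+ j.
  by rewrite subrXX dvdp_mulr.
rewrite -[j in qs ^+ j]card_ord -prodr_const bigA_distr_big coef_sum.
rewrite [RHS]big_mkcond [LHS]big_mkcond; apply: eq_bigr => m _.
have -> : (m \in ffun_on (fun k : 'I_s.+1 => 3 <= k)%N) = [forall i, 3 <= m i]%N.
  by apply/ffun_onP/forallP.
case: forallP => //= m3; rewrite scaler_prod coefZ.
rewrite prodrXr /= coefXn.
have -> : (d == \sum_i (m i - 2))%N = (\sum_i m i == s)%N.
  have -> : (\sum_i m i = \sum_i (m i - 2) + 2 * j)%N.
    have -> : (2 * j = \sum_(i < j) 2)%N by rewrite sum_nat_const card_ord mulnC.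
    rewrite -big_split /=.
    by apply: eq_bigr => i _; have := m3 i; lia.
  by rewrite eqn_add2r eq_sym.
by case: eqP; rewrite ?mulr1 ?mulr0.
Qed.

(* The polynomial P of the header. *)
Definition structure_poly (n : nat) : {poly K} :=
  \poly_(i < n) (if (1 < i)%N then z i.+1 else 0).

Lemma dvdX2_structure_poly n : 'X^2 %| structure_poly n.
Proof. by apply/dvdXnP=> -[|[|i]] // _; rewrite coef_poly if_same. Qed.

(** With P = X q the base is A X (1 + y q), so up to A^(k-1) the coefficient is that of X^(t-k) in
    (1 + y q)^(k-1). For k < t the binomial terms with j >= 1 form S_{t,k} and j = 0 gives nothing;
    for k = t only j = 0 survives, as q(0) = 0. *)
Lemma coef_transported_exp (n k t : nat) (A y : K) :
  (3 <= k <= t)%N -> (t <= n)%N ->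
  ((A *: ('X + y *: structure_poly n)) ^+ k.-1)`_t.-1 =
    A ^+ k.-1 * (if k == t then 1 else S_poly y z t k).
Proof.
move=> /andP[k3 kt] tn.
pose q : {poly K} := \poly_(i < n.-1) (if (0 < i)%N then z i.+2 else 0).
have -> : structure_poly n = q * 'X.
  apply/polyP=> i; rewrite coefMX !coef_poly; case: i => [|i] /=; first by rewrite if_same.
  by rewrite (_ : (i < n.-1)%N = (i.+1 < n)%N) //; lia.
rewrite scalerAl -{1}['X]mul1r -mulrDl exprZn coefZ exprMn coefMXn.
rewrite (_ : (t.-1 < k.-1)%N = false); last lia.
rewrite (_ : (t.-1 - k.-1 = t - k)%N); last lia.
congr (_ * _); rewrite exprDn coef_sum.
rewrite (eq_bigr (fun i : 'I_k.-1.+1 =>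
  'C(k.-1, i)%:R * y ^+ i * (q ^+ i)`_(t - k))) => [|i _]; last first.
  by rewrite expr1n mul1r coefMn exprZn coefZ -mulrA mulr_natl.
rewrite -(big_mkord xpredT (fun i => 'C(k.-1, i)%:R * y ^+ i * (q ^+ i)`_(t - k))).
rewrite big_ltn // bin0 !expr0 !mul1r coef1 prednK; last lia.
have E : \sum_(1 <= i < k) 'C(k.-1, i)%:R * y ^+ i * (q ^+ i)`_(t - k) =
         if k == t then 0 else S_poly y z t k.
  case: eqP => [<-|k_t].
    rewrite subnn big_nat big1 // => i /andP[i0 _].
    have /dvdXnP -> // : 'X^i %| q ^+ i; last by rewrite mulr0.
    by apply: dvdXn_exp; rewrite coef_poly if_same.
  apply: eq_big_nat => j /andP[j0 jk]; congr (_ * _).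
  apply: coef_expr_tuples => // i lei; rewrite coef_poly.
  by rewrite (_ : (i < n.-1)%N = true) //; lia.
rewrite E; case: (eqVneq k t) => [->|k_t]; first by rewrite subnn eqxx addr0.
by rewrite (_ : (t - k == 0)%N = false) ?add0r //; lia.
Qed.

End Coefficients.

(** * Coefficients of the transported structure polynomial *)

(* Below y = B/A, so that A + B = A (1 + y). *)
Section Transport.
Variables (K : fieldType) (n : nat) (z z' : nat -> K) (A y : K).
Hypothesis A0 : A != 0.

Let g := A *: ('X + y *: structure_poly z n).

Lemma coef0_transported : g`_0 = 0.
Proof.
rewrite coefZ coefD coefX coefZ.
by have /dvdXnP -> := dvdX2_structure_poly z n; rewrite // mulr0 addr0 mulr0.
Qed.

Lemma coef1_transported : g`_1 = A.
Proof.
rewrite coefZ coefD coefX coefZ.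
by have /dvdXnP -> := dvdX2_structure_poly z n; rewrite // mulr0 addr0 mulr1.
Qed.

(** The entry z'_k sits at exponent k - 1, and X^i divides g^i, so only k <= t can reach X^(t-1); k
    = t gives the leading term. *)
Lemma coef_structure_comp t : (3 <= t <= n)%N ->
  (structure_poly z' n \Po g)`_t.-1 =
    A ^+ t.-1 * z' t + \sum_(3 <= k < t) A ^+ k.-1 * S_poly y z t k * z' k.
Proof.
move=> /andP[t3 tn]; rewrite /structure_poly poly_def linear_sum coef_sum /=.
rewrite (eq_bigr (fun i : 'I_n =>
  (if (1 < i)%N then z' i.+1 else 0) * (g ^+ i)`_t.-1)) => [|i _]; last first.
  by rewrite comp_polyZ comp_Xn_poly coefZ.
rewrite -(big_mkord xpredT (fun i =>
  (if (1 < i)%N then z' i.+1 else 0) * (g ^+ i)`_t.-1)).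
rewrite (@big_cat_nat _ _ _ 2) //=; [rewrite big_nat big1 ?add0r; last first|lia].
  by move=> i /andP[_ i2]; rewrite ltnNge -ltnS i2 mul0r.
rewrite (@big_cat_nat _ _ _ t) //=; [|lia..].
rewrite [X in _ + X]big_nat [X in _ + X]big1 ?addr0; last first.
  move=> i /andP[ti _]; have /dvdXnP -> := dvdXn_exp i coef0_transported; last lia.
  by rewrite mulr0.
rewrite -{1}(@prednK t); last lia.
rewrite big_nat_recr /=; last lia.
rewrite addrC (_ : (1 < t.-1)%N = true); last lia.
rewrite (prednK (_ : 0 < t)%N); last lia.
rewrite coef_transported_exp // ?eqxx ?leqnn ?t3 // mulr1 mulrC.
congr (_ + _); rewrite [RHS]big_add1; apply: eq_big_nat => k /andP[k2 kt].
rewrite k2 -[k in g ^+ k]/(k.+1.-1) coef_transported_exp //; last lia.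
by rewrite (_ : (k.+1 == t)%N = false) 1?mulrC //; lia.
Qed.

(** After division by A, vanishing of the coefficient of X^(t-1) is the recursion for [phi], with
    A^(k-2) z'_k in place of phi_k. *)
Lemma structure_comp_phi :
  'X^n %| structure_poly z' n \Po g - (A * (1 + y)) *: structure_poly z n <->
  (forall t, (3 <= t <= n)%N -> A ^+ t.-2 * z' t = phi y z t).
Proof.
have AS t : (3 <= t)%N -> A ^+ t.-1 = A * A ^+ t.-2.
  by move=> t3; rewrite -exprS; congr (_ ^+ _); lia.
have coefE_t t : (3 <= t <= n)%N ->
    (structure_poly z' n \Po g - (A * (1 + y)) *: structure_poly z n)`_t.-1 =
    A * (A ^+ t.-2 * z' t - ((1 + y) * z t -
            \sum_(3 <= k < t) S_poly y z t k * (A ^+ k.-2 * z' k))).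
  move=> tn; have /andP[t3 t_n] := tn; rewrite coefB coef_structure_comp // coefZ coef_poly.
  rewrite (_ : (t.-1 < n)%N = true); last lia.
  rewrite (_ : (1 < t.-1)%N = true); last lia.
  rewrite prednK; last lia.
  rewrite (eq_big_nat _ _ (F2 := fun k => A * (S_poly y z t k * (A ^+ k.-2 * z' k)))).
    by rewrite -mulr_sumr AS //; ring.
  by move=> k /andP[k3 kt]; rewrite AS //; ring.
split=> [/dvdXnP dvd t|phiE].
  (* Strong induction: the equation at t involves only indices below t in its sum. *)
  have [b] := ubnP t; elim: b t => // b IHb t tb tn.
  have := dvd t.-1; rewrite coefE_t // => /(_ _)/eqP; rewrite mulf_eq0 (negPf A0) /=.
  have t_n : (t.-1 < n)%N by lia.
  move=> /(_ t_n); rewrite subr_eq0 => /eqP ->.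
  rewrite [RHS]phi_eq; congr (_ - _); apply: eq_big_nat => k kt.
  by rewrite IHb //; lia.
(* Exponents 0 and 1 carry no entry; there both terms vanish, since X^2 divides both structure
   polynomials. *)
apply/dvdXnP=> i lin; have [i2|i2] := ltnP i 2.
  have g0 := coef0_transported.
  have dvd2 : 'X^2 %| structure_poly z' n \Po g - (A * (1 + y)) *: structure_poly z n.
    by rewrite dvdp_sub ?dvdXn_comp ?dvdX2_structure_poly // -mul_polyC dvdp_mull ?dvdX2_structure_poly.
  by move/dvdXnP: dvd2 => ->.
have [t it] : exists t, i = t.-1 by exists i.+1.
rewrite it coefE_t; last lia.
rewrite phiE; last lia.
rewrite (eq_big_nat _ _ (F2 := fun k => S_poly y z t k * phi y z k)).
  by rewrite -phi_eq subrr mulr0.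
by move=> k /andP[k3 kt]; rewrite phiE //; lia.
Qed.

Lemma phi_lastE : (3 <= n)%N ->
  phi_last y z n = phi y z n + (z n.+1 - z n).
Proof. by move=> n3; rewrite phi_eq /phi_last; ring. Qed.

(** Here x = 1/A and i stands for t = i + 2. At i = n - 1 the conditions on z'_n and on delta, both
    with factor A^(n-2), add up to the one on z'_{n+1}; subtracting recovers delta. *)
Lemma transport_rho : (4 <= n)%N ->
  ('X^n %| structure_poly z' n \Po g - (A * (1 + y)) *: structure_poly z n /\
   z n.+1 - z n = A ^+ (n - 2) * (z' n.+1 - z' n)) <->
  (forall i, (1 <= i <= n - 1)%N -> z' i.+2 = rho n i A^-1 y z).
Proof.
move=> n4; rewrite structure_comp_phi /rho.
have AnK m u v : A ^+ m * u = v <-> u = A^-1 ^+ m * v.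
  rewrite exprVn; split=> [<-|->]; first by rewrite mulKf ?expf_neq0.
  by rewrite mulVKf ?expf_neq0.
split=> [[phiE dE] i /andP[i1 i_n]|rhoE].
  case: eqP => [->|i_n1].
    rewrite (_ : n.-1.+2 = n.+1); last lia.
    apply/AnK; rewrite phi_lastE ?dE -?phiE; [|lia..].
    by rewrite subn2; ring.
  by apply/AnK; rewrite -phiE //; lia.
have phiE t : (3 <= t <= n)%N -> A ^+ t.-2 * z' t = phi y z t.
  move=> tn; apply/AnK; have := rhoE t.-2.
  have t2 : t.-2.+2 = t by lia.
  by rewrite t2 => ->; [case: eqP => //; lia|lia].
split=> //; have := rhoE n.-1; rewrite eqxx (_ : n.-1.+2 = n.+1); last lia.
have n1 : (1 <= n.-1 <= n - 1)%N by lia.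
move=> /(_ n1)/AnK E; rewrite mulrBr E phi_lastE; last lia.
by rewrite subn2 phiE; [ring|lia].
Qed.

End Transport.

(** * Truncated polynomial model of the algebra *)

Section Model.
Variables (K : fieldType) (n : nat).

(* The element c f + p, where f = e_0 - e_1. *)
Definition vec (c : K) (p : {poly K}) : 'rV[K]_n.+1 :=
  \row_j (if j == 0%N :> nat then c else p`_j.-1 - c *+ (j == 1%N :> nat)).

(* Since e_0 = f + 1 and e_1 = 1, both contribute to the constant term
   (0.-1 = 0). *)
Definition poly_of (u : 'rV[K]_n.+1) : {poly K} :=
  \sum_(i < n.+1) u 0 i *: 'X^(i.-1).

Lemma vec_linear a c1 p1 c2 p2 :
  a *: vec c1 p1 + vec c2 p2 = vec (a * c1 + c2) (a *: p1 + p2).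
Proof.
apply/rowP=> j; rewrite !mxE; case: eqP => // _.
by rewrite coefD coefZ mulrnDl -mulrnAr mulrBr addrACA opprD.
Qed.

Lemma vecD c1 p1 c2 p2 : vec c1 p1 + vec c2 p2 = vec (c1 + c2) (p1 + p2).
Proof. by rewrite -[vec c1 p1]scale1r vec_linear mul1r scale1r. Qed.

Lemma vec0 : vec 0 0 = 0.
Proof. by apply/rowP=> j; rewrite !mxE mul0rn coef0 subrr if_same. Qed.

Lemma vecZ a c p : a *: vec c p = vec (a * c) (a *: p).
Proof. by have := vec_linear a c p 0 0; rewrite vec0 !addr0. Qed.

Lemma vec0_sum I (r : seq I) (P : pred I) (F : I -> {poly K}) :
  \sum_(i <- r | P i) vec 0 (F i) = vec 0 (\sum_(i <- r | P i) F i).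
Proof.
apply/esym/(big_morph (vec 0)); last exact: vec0.
by move=> p q; rewrite vecD addr0.
Qed.

(** Only coefficients below degree n are stored, so polynomials count modulo X^n. *)
Lemma vecP c1 p1 c2 p2 :
  vec c1 p1 = vec c2 p2 <-> c1 = c2 /\ 'X^n %| p1 - p2.
Proof.
split=> [/rowP E|[-> /dvdXnP dvd]].
  have c12 : c1 = c2 by have := E ord0; rewrite !mxE.
  split=> //; apply/dvdXnP=> i lin; have i1 : (i.+1 < n.+1)%N by [].
  have := E (Ordinal i1); rewrite !mxE /= c12 coefB => /addIr ->.
  by rewrite subrr.
apply/rowP=> -[[|j] jn]; rewrite !mxE //=; congr (_ - _).
by apply/eqP; rewrite -subr_eq0 -coefB dvd.
Qed.

Lemma vec0_eq0 p : vec 0 p = 0 <-> 'X^n %| p.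
Proof. by rewrite -vec0 vecP subr0; split=> [[]|]. Qed.

Lemma poly_of_linear a u v : poly_of (a *: u + v) = a *: poly_of u + poly_of v.
Proof.
rewrite /poly_of scaler_sumr -big_split; apply: eq_bigr => i _ /=.
by rewrite !mxE scalerA -scalerDl.
Qed.

Lemma poly_ofK (u : 'rV[K]_n.+1) : vec (u 0 0) (poly_of u) = u.
Proof.
apply/rowP=> j; rewrite mxE; case: eqP => [j0|/eqP j0].
  by congr (u _ _); apply: val_inj.
rewrite coef_sum big_ord_recl coefZ coefXn /=.
have jn : (j.-1 < n)%N by have := ltn_ord j; lia.
rewrite (bigD1 (Ordinal jn)) //= big1 ?addr0 => [|i]; last first.
  rewrite -val_eqE /= => ij; rewrite coefZ coefXn (_ : (j.-1 == i)%N = false) ?mulr0 //.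
  by lia.
rewrite coefZ coefXn eqxx mulr1 (_ : (j.-1 == 0%N) = (j == 1%N :> nat)); last lia.
rewrite mulr_natr.
rewrite addrC addKr; congr (u _ _); apply: val_inj => /=; rewrite /bump /=; lia.
Qed.

Lemma vec_surj u : exists c p, u = vec c p.
Proof. by exists (u 0 0), (poly_of u); rewrite poly_ofK. Qed.

Lemma poly_of_vec c p : 'X^n %| poly_of (vec c p) - p.
Proof.
suff /vecP[] : vec c (poly_of (vec c p)) = vec c p by [].
by rewrite -[RHS]poly_ofK mxE.
Qed.

(** * The bracket in polynomial terms *)

Section Bracket.
Hypothesis n4 : (4 <= n)%N.

(** At t = 0 the truncated predecessor yields X^0 = 1, in accordance with e_0 = f + 1. *)
Lemma e_vec t : (t <= n)%N -> e_ K n t = vec (t == 0%N)%:R 'X^(t.-1).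
Proof.
move=> tn; apply/rowP=> j; rewrite !mxE coefXn; case: (eqVneq (j : nat) 0%N) => [->|j0].
  by rewrite eq_sym.
case: (eqVneq t 0%N) => [->|t0].
  by rewrite (negPf j0) /= (_ : (j.-1 == 0%N) = (j == 1%N :> nat)) ?subrr //; lia.
rewrite mul0rn subr0; congr (_%:R); congr nat_of_bool; lia.
Qed.

Lemma e_vec_pos t : (0 < t)%N -> (t <= n)%N -> e_ K n t = vec 0 'X^(t.-1).
Proof. by move=> t0 tn; rewrite e_vec // (_ : (t == 0)%N = false) //; lia. Qed.

Variable alpha : (n.-1).-tuple K.
Let P := structure_poly (at3 alpha) n.
Let delta := at3 alpha n.+1 - at3 alpha n.

Lemma basis_bracket0 i : (i <= n)%N ->
  basis_bracket alpha i 0 = vec 0 ('X * 'X^(i.-1)).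
Proof.
move=> i_n /=; rewrite -exprS; case: eqP => [->|/eqP i0].
  by rewrite e_vec_pos //; lia.
rewrite prednK; last lia.
case: leqP => i1; first by rewrite e_vec_pos //; lia.
by apply/esym/vec0_eq0; rewrite dvdp_exp2l //; lia.
Qed.

(** [e_0, e_1] and [e_1, e_1] differ only at e_n, by theta - alpha_n = delta. For i >= 1, cutting
    off the sum in the bracket is reduction modulo X^n. *)
Lemma basis_bracket1 i : (i <= n)%N ->
  basis_bracket alpha i 1 =
  vec 0 (P * 'X^(i.-1) + (delta *+ (i == 0%N)) *: 'X^(n.-1)).
Proof.
have PE : P = \sum_(3 <= t < n.+1) at3 alpha t *: 'X^(t.-1).
  rewrite /P /structure_poly poly_def.
  rewrite -(big_mkord xpredT (fun i => (if (1 < i)%N then at3 alpha i.+1 else 0) *: 'X^i)).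
  rewrite (@big_cat_nat _ _ _ 2) //=; last lia.
  rewrite big_nat big1 ?add0r; last first.
    by move=> k /andP[_ k2]; rewrite ltnNge -ltnS k2 scale0r.
  by rewrite [RHS]big_add1; apply: eq_big_nat => k /andP[-> _].
move=> i_n /=; case: eqP => [->|/eqP i0].
  rewrite mulr1 PE big_nat_recr /=; last lia.
  rewrite -addrA -scalerDl mulr1n (_ : at3 alpha n + delta = at3 alpha n.+1); last by rewrite /delta addrC subrK.
  rewrite e_vec_pos; [|lia..].
  rewrite vecZ (eq_big_nat _ _ (F2 := fun t => vec 0 (at3 alpha t *: 'X^(t.-1)))).
    by rewrite vec0_sum vecD mulr0 addr0.
  by move=> t /andP[t3 tn]; rewrite e_vec_pos ?vecZ ?mulr0 //; lia.
rewrite mulr0n scale0r addr0 PE mulr_suml.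
have E t : (3 <= t)%N -> at3 alpha t *: 'X^(t.-1) * 'X^(i.-1) =
    at3 alpha t *: 'X^(i + t - 2) :> {poly K}.
  by move=> t3; rewrite -scalerAl -exprD; congr (_ *: 'X^_); lia.
case: leqP => i2; last first.
  apply/esym/vec0_eq0; rewrite big_nat; apply: (big_ind (fun p => 'X^n %| p)) => [||t /andP[t3 tn]].
  - by rewrite dvdp0.
  - by move=> p q; exact: dvdp_add.
  by rewrite E // -mul_polyC dvdp_mull // dvdp_exp2l //; lia.
rewrite [in RHS](@big_cat_nat _ _ _ (n.+2 - i)) /=; [|lia..].
rewrite (eq_big_nat _ _ (F2 := fun t => vec 0 (at3 alpha t *: 'X^(t.-1) * 'X^(i.-1)))).
  rewrite vec0_sum; apply/vecP; split=> //.
  rewrite opprD addrA subrr sub0r dvdpNr big_nat.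
  apply: (big_ind (fun p => 'X^n %| p)) => [||t /andP[t3 tn]]; first by rewrite dvdp0.
    by move=> p q; exact: dvdp_add.
  by rewrite E ?dvdp_mull -?mul_polyC ?dvdp_mull ?dvdp_exp2l //; lia.
move=> t /andP[t3 tn]; rewrite e_vec_pos; [|lia..].
by rewrite vecZ mulr0 E // (_ : (i + t - 1).-1 = (i + t - 2)%N) //; lia.
Qed.

(** c f + p has e_0-coordinate c and e_1-coordinate p(0) - c, and only right multiplications by e_0
    and e_1 are nonzero. *)
Lemma bracket_vec c1 p1 c2 p2 :
  L_bracket alpha (vec c1 p1) (vec c2 p2) =
  vec 0 (p1 * (c2 *: 'X + (p2`_0 - c2) *: P) +
         (c1 * (p2`_0 - c2) * delta) *: 'X^(n.-1)).
Proof.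
set u := vec c1 p1; set v := vec c2 p2.
have v0 : v 0 (inord 0) = c2 by rewrite mxE inordK.
have v1 : v 0 (inord 1) = p2`_0 - c2 by rewrite mxE inordK //; lia.
have -> : L_bracket alpha u v =
    vec 0 (poly_of u * (c2 *: 'X + (p2`_0 - c2) *: P) +
           (c1 * (p2`_0 - c2) * delta) *: 'X^(n.-1)).
  rewrite /L_bracket (eq_bigr (fun i : 'I_n.+1 => vec 0 (
     (u 0 i *: 'X^(i.-1)) * (c2 *: 'X + (p2`_0 - c2) *: P) +
     (u 0 i * (p2`_0 - c2) * delta *+ (i == 0%N :> nat)) *: 'X^(n.-1)))).
    rewrite vec0_sum big_split /= -mulr_suml -scaler_suml.
    congr (vec 0 (_ + _ *: _)); rewrite big_ord_recl big1 ?addr0 //=.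
    by rewrite mxE.
  move=> i _; have i_n : (i <= n)%N by rewrite -ltnS.
  rewrite (bigD1 (inord 0)) //= (bigD1 (inord 1)) /=; last first.
    by rewrite -val_eqE /= !inordK //; lia.
  rewrite big1 ?addr0; last first.
    move=> [[|[|j]] jn]; rewrite -!val_eqE /= !inordK //; try lia.
    by rewrite scaler0.
  rewrite v0 v1 !inordK //; last lia.
  rewrite basis_bracket0 // basis_bracket1 // !vecZ vecD !mulr0 addr0.
  congr (vec 0 _); rewrite -!mul_polyC !rmorphM /= rmorphMn /=.
  by case: (i == 0%N :> nat); rewrite ?mulr1n ?mulr0n; ring.
(* [poly_of u] is congruent to p1 modulo X^n, hence may be replaced by it. *)
apply/vecP; split=> //; rewrite opprD addrACA subrr addr0 -mulrBl.
by rewrite dvdp_mulr // poly_of_vec.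
Qed.

End Bracket.
End Model.

(** * Isomorphisms *)

Section Isomorphisms.
Variables (K : fieldType) (n : nat) (alpha alpha' : (n.-1).-tuple K).
Hypothesis n4 : (4 <= n)%N.

Let P := structure_poly (at3 alpha) n.
Let P' := structure_poly (at3 alpha') n.
Let delta := at3 alpha n.+1 - at3 alpha n.
Let delta' := at3 alpha' n.+1 - at3 alpha' n.

(** The map sends p to d p(g) and f to A f - A y delta X^(n-2). Right multiplication by the image A
    e_0 + A y e_1 + ... of e_0 sends A f to A^2 y delta X^(n-1); the correction in X^(n-2) cancels
    this, as required by [f, e_0] = 0. *)
Lemma isomorphic_of_transport (A y : K) :
  A != 0 -> 1 + y != 0 ->
  'X^n %| P' \Po (A *: ('X + y *: P)) - (A * (1 + y)) *: P ->
  delta = A ^+ (n - 2) * delta' ->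
  isomorphic (L alpha') (L alpha).
Proof.
move=> A0 y1; set g := A *: _; set d := A * (1 + y) => dvdP dE.
have g0 : g`_0 = 0 := coef0_transported n (at3 alpha) A y.
have g1 : g`_1 = A := coef1_transported n (at3 alpha) A y.
have d0 : d != 0 by rewrite mulf_neq0.
pose F (u : 'rV[K]_n.+1) : 'rV[K]_n.+1 :=
  vec n (A * u 0 0)
    (d *: (poly_of u \Po g) - (u 0 0 * (A * y) * delta) *: 'X^(n - 2)).
have FE c p : F (vec n c p) = vec n (A * c)
    (d *: (p \Po g) - (c * (A * y) * delta) *: 'X^(n - 2)).
  rewrite /F; apply/vecP; rewrite mxE; split=> //.
  rewrite opprB addrA subrK -scalerBr -comp_polyB.
  by rewrite dvdpZr // dvdXn_comp // poly_of_vec.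
have Flin : linear F.
  move=> a u v; rewrite /F vec_linear poly_of_linear !mxE; congr vec; first ring.
  rewrite comp_polyD comp_polyZ -!mul_polyC !rmorphM !rmorphD !rmorphM /=; ring.
have Finj : injective F.
  suff F0 u : F u = 0 -> u = 0.
    move=> u v Fuv; apply/eqP; rewrite -subr_eq0; apply/eqP/F0.
    by rewrite -scaleN1r addrC Flin Fuv scaleN1r addNr.
  have [c [p ->]] := vec_surj u; rewrite FE -vec0 => /vecP[/eqP].
  rewrite mulf_eq0 (negPf A0) /= => /eqP ->.
  rewrite !mul0r scale0r !subr0 dvdpZr // => dvdp.
  by apply/vecP; split=> //; rewrite subr0; apply: dvdXn_comp_inv dvdp; rewrite ?g1.
have FM u v : F (L_bracket alpha' u v) = L_bracket alpha (F u) (F v).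
  have [c1 [p1 ->]] := vec_surj u; have [c2 [p2 ->]] := vec_surj v.
  rewrite bracket_vec // !FE bracket_vec // mulr0; apply/vecP; split=> //.
  have -> : (d *: (p2 \Po g) - (c2 * (A * y) * delta) *: 'X^(n - 2))`_0 = d * p2`_0.
    rewrite coefB !coefZ coefXn coef0_comp_poly // (_ : (0 == n - 2)%N = false) ?mulr0 ?subr0 //.
    by lia.
  rewrite -/P' -/P -/delta -/delta' comp_polyD comp_polyM comp_polyD !comp_polyZ.
  rewrite comp_polyX comp_Xn_poly !mul0r scale0r subr0.
  (* Divisibilities are turned into equations with cofactors: S for P, V for g^(n-1), U for P'(g).
     Then [ring] exhibits the defect of multiplicativity as an explicit multiple of X^n. *)
  have /dvdpP[S PE] : 'X^2 %| P := dvdX2_structure_poly (at3 alpha) n.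
  have /dvdpP[V VE] := dvdXn_lead_exp n.-1 g0.
  case/dvdpP: dvdP => U UE.
  have /eqP := UE; rewrite subr_eq => /eqP ->.
  have /eqP := VE; rewrite subr_eq g1 => /eqP ->.
  have gE : g = A *: ('X + y *: P) by [].
  have X1E : 'X^(n.-1) = 'X * 'X^(n - 2) :> {poly K}.
    by rewrite -exprS; congr (_ ^+ _); lia.
  have A1E : A ^+ n.-1 = A * A ^+ (n - 2).
    by rewrite -exprS; congr (_ ^+ _); lia.
  have X2E : 'X^n = 'X ^+ 2 * 'X^(n - 2) :> {poly K}.
    by rewrite -exprD; congr (_ ^+ _); lia.
  have V1E : 'X^(n.-1.+1) = 'X^n :> {poly K} by congr (_ ^+ _); lia.
  have dE' : d = A * (1 + y) by [].
  clear UE VE FE Flin Finj F g0 g1 d0; clearbody delta delta' P P' g d.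
  rewrite dE V1E A1E X1E X2E gE PE dE' -!mul_polyC.
  set p1g := p1 \Po _; set e := p2`_0.
  set D := (X in _ %| X).
  have -> : D = ((A * (1 + y) * (e - c2))%:P * (p1g * U + (c1 * delta')%:P * V) +
      (c1 * (A * y) * (A ^+ (n - 2) * delta') * (A * (1 + y) * e - A * c2))%:P * S) *
      ('X ^+ 2 * 'X^(n - 2)).
    by rewrite /D; ring.
  by rewrite dvdp_mull.
pose Fl : {linear 'rV[K]_n.+1 -> 'rV[K]_n.+1} :=
  HB.pack F (GRing.isLinear.Build _ _ _ _ F Flin).
(* An injective endomorphism of a finite-dimensional space is bijective. *)
have F_lker : lker (linfun Fl) == 0%VS.
  by apply/lker0P => u v; rewrite !lfunE; apply: Finj.
exists Fl; split=> //.
exists (linfun Fl)^-1%VF => u.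
  by have := lker0_lfunK F_lker u; rewrite lfunE.
by have := lker0_lfunVK F_lker u; rewrite lfunE.
Qed.

(** * Recovering A and y from an injective morphism *)

Section Necessity.
Variable F : 'rV[K]_n.+1 -> 'rV[K]_n.+1.
Hypotheses (Flin : linear F) (Finj : injective F).
Hypothesis FM : {morph F : u v / L_bracket alpha' u v >-> L_bracket alpha u v}.

(** F carries right multiplication by e_0, which is X, to right multiplication by F e_0, which is T
    on vectors without f-part. This determines F on polynomials from F e_1; the products with e_1
    then give the two conditions. *)
Lemma transport_of_morphism : exists A y : K,
  [/\ A != 0, 1 + y != 0,
      'X^n %| P' \Po (A *: ('X + y *: P)) - (A * (1 + y)) *: P &
      delta = A ^+ (n - 2) * delta'].
Proof.
(* The vectors [vec n 1 1] and [vec n 0 1] are e_0 and e_1. *)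
have [c0 [w0 Fe0]] := vec_surj (F (vec n 1 1)).
have [c1 [w1 Fe1]] := vec_surj (F (vec n 0 1)).
pose b := w0`_0 - c0; pose T := c0 *: 'X + b *: P.
have F0 : F 0 = 0.
  by have := Flin 1 0 0; rewrite !scale1r addr0 => /eqP; rewrite -subr_eq0 opprD addNKr oppr_eq0 => /eqP.
have br0 q : L_bracket alpha' (vec n 0 q) (vec n 1 1) = vec n 0 (q * 'X).
  by rewrite bracket_vec // coef1 subrr !scale0r !mul0r scale0r !addr0 scale1r.
have br1 q : L_bracket alpha' (vec n 0 q) (vec n 0 1) = vec n 0 (q * P').
  by rewrite bracket_vec // coef1 subr0 !scale0r !mul0r scale0r !addr0 add0r scale1r.
have br00 : L_bracket alpha' (vec n 1 1) (vec n 1 1) = vec n 0 'X.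
  by rewrite bracket_vec // coef1 subrr !scale0r mulr0 mul0r scale0r !addr0 scale1r mul1r.
have br01 : L_bracket alpha' (vec n 1 1) (vec n 0 1) = vec n 0 (P' + delta' *: 'X^(n.-1)).
  by rewrite bracket_vec // coef1 subr0 !scale0r add0r !mul1r scale1r.
(* Horner induction on p, each factor X being a right multiplication by e_0. *)
have Fmul q g : F (vec n 0 q) = vec n 0 g ->
    forall p, F (vec n 0 (q * p)) = vec n 0 (g * (p \Po T)).
  move=> Fq; apply: poly_ind => [|p c IHp].
    by rewrite comp_poly0 !mulr0 vec0.
  have -> : vec n 0 (q * (p * 'X + c%:P)) =
      c *: vec n 0 q + L_bracket alpha' (vec n 0 (q * p)) (vec n 1 1).
    by rewrite br0 vec_linear mulr0 addr0 mulrDr mulrA addrC mulrC mul_polyC.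
  rewrite Flin FM IHp Fq Fe0 bracket_vec // vec_linear mulr0 addr0.
  rewrite !mul0r scale0r addr0 comp_polyD comp_polyM comp_polyX comp_polyC.
  by congr vec; rewrite -/b -/P -/T -mul_polyC; ring.
have /dvdpP[S PE] : 'X^2 %| P := dvdX2_structure_poly (at3 alpha) n.
have TE : T = 'X * (c0%:P + b%:P * S * 'X).
  by rewrite /T PE -!mul_polyC; ring.
have T0 : T`_0 = 0 by rewrite TE coefXM.
have T1 : T`_1 = c0 by rewrite TE coefXM /= coefD coefC coefMX addr0.
set H := c0%:P + _ in TE.
have H0 : H`_0 = c0 by rewrite coefD coefC coefMX addr0.
have X1E : 'X^(n.-1) = 'X * 'X^(n - 2) :> {poly K}.
  by rewrite -exprS; congr (_ ^+ _); lia.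
have XnE : 'X^n = 'X * 'X^(n.-1) :> {poly K}.
  by rewrite -exprS; congr (_ ^+ _); lia.
have Xn0 : ~ 'X^n %| ('X^(n.-1) : {poly K}).
  move/dvdXnP/(_ n.-1); rewrite coefXn eqxx => E.
  have /E/eqP : (n.-1 < n)%N by lia.
  by rewrite oner_eq0.
(* F e_2 = [F e_1, F e_0] = X h2; the term with delta comes from a possible f-part c1 of F e_1. *)
pose h2 := w1 * H + (c1 * b * delta) *: 'X^(n - 2).
have FX : F (vec n 0 'X) = vec n 0 ('X * h2).
  have -> : vec n 0 'X = L_bracket alpha' (vec n 0 1) (vec n 1 1).
    by rewrite br0 mul1r.
  rewrite FM Fe0 Fe1 bracket_vec // -/b -/P -/delta -/T TE X1E /h2; congr vec.
  by rewrite -!mul_polyC; ring.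
have ndvd : ~ 'X^n %| 'X * h2 * T ^+ (n - 2).
  move=> dvd; apply: Xn0; apply/(vec0_eq0 n)/Finj; rewrite F0.
  rewrite X1E (Fmul _ _ FX) comp_Xn_poly; exact/vec0_eq0.
(* F e_n = X h2 T^(n-2) is nonzero, so X h2 and T have order exactly 1. *)
have h20 : h2`_0 != 0.
  apply/negP; rewrite -dvdX_coef0 => dvd; apply: ndvd.
  by rewrite XnE X1E mulrA !dvdp_mul // dvdXn_exp.
have c00 : c0 != 0.
  apply/eqP => c00; apply: ndvd; rewrite XnE -mulrA dvdp_mul // dvdp_mull //.
  (* If c0 = 0 then X^2 divides T, and 2(n-2) >= n-1. *)
  apply: dvdp_trans (_ : 'X^(2 * (n - 2)) %| _); first by rewrite dvdp_exp2l //; lia.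
  rewrite exprM dvdp_exp2r // TE expr2 dvdp_mul // dvdX_coef0 H0 c00 eqxx //.
(* [e_2, e_1] = P' e_2 forces the linear coefficient c1 of [-, F e_1] to vanish. *)
have c10 : c1 = 0.
  have : F (vec n 0 ('X * P')) = L_bracket alpha (vec n 0 ('X * h2)) (vec n c1 w1).
    by rewrite -br1 FM FX Fe1.
  rewrite (Fmul _ _ FX) bracket_vec // !mul0r scale0r addr0 => /vecP[_].
  rewrite -mulrBr -mulrA XnE dvdp_mul2l ?polyX_eq0 // Gauss_dvdpr ?coprimep_Xn //.
  (* After cancelling X h2, the coefficient of X is 0 in P'(T) and c1 on the other side. *)
  move/dvdXnP/(_ 1%N); rewrite coefB.
  have /dvdXnP -> // : 'X^2 %| P' \Po T by rewrite dvdXn_comp ?dvdX2_structure_poly.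
  have /dvdXnP P0 := dvdX2_structure_poly (at3 alpha) n.
  rewrite coefD !coefZ coefX P0 // mulr0 addr0 mulr1 sub0r => E.
  by apply/eqP; rewrite -oppr_eq0 E //; lia.
rewrite {}c10 {h2 FX ndvd h20} in Fe1 *.
set d := w1`_0 in Fe1 *.
have FE p : F (vec n 0 p) = vec n 0 (w1 * (p \Po T)).
  by rewrite -[p in LHS]mul1r; apply: Fmul.
(* Otherwise F e_n = w1 T^(n-1) would vanish modulo X^n. *)
have d0 : d != 0.
  apply/negP; rewrite -dvdX_coef0 => dvd; apply: Xn0; apply/(vec0_eq0 n)/Finj.
  rewrite F0 FE comp_Xn_poly; apply/vec0_eq0.
  by rewrite XnE dvdp_mul // dvdXn_exp.
have dvd1 : 'X^n %| P' \Po T - d *: P.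
  have : F (vec n 0 P') = L_bracket alpha (vec n 0 w1) (vec n 0 w1).
    by rewrite -[P']mul1r -br1 FM Fe1.
  rewrite FE bracket_vec // !mul0r !scale0r addr0 add0r subr0 => /vecP[_].
  by rewrite -mulrBr Gauss_dvdpr // coprimep_Xn.
(* Since [e_0, e_0] = [e_1, e_0], the products w0 T and w1 T agree up to a multiple of X^(n-1); T
   has order exactly 1. *)
have dvd2 : 'X^(n - 2) %| w0 - w1.
  have : F (vec n 0 'X) = L_bracket alpha (vec n c0 w0) (vec n c0 w0).
    by rewrite -br00 FM Fe0.
  rewrite FE comp_polyX bracket_vec // -/b -/T TE => /vecP[_].
  have -> : w1 * ('X * H) - (w0 * ('X * H) + (c0 * b * delta) *: 'X^(n.-1)) =
      'X * (- ((w0 - w1) * H + (c0 * b * delta) *: 'X^(n - 2))).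
    by rewrite X1E -!mul_polyC; ring.
  rewrite XnE dvdp_mul2l ?polyX_eq0 // dvdpNr => dvd.
  have : 'X^(n - 2) %| (w0 - w1) * H + (c0 * b * delta) *: 'X^(n - 2).
    by apply: dvdp_trans dvd; rewrite dvdp_exp2l //; lia.
  rewrite dvdp_addl; last by rewrite -mul_polyC dvdp_mull.
  by rewrite Gauss_dvdpl // coprimep_Xn // H0.
have w00 : w0`_0 = d.
  by apply/eqP; rewrite -subr_eq0 -coefB; move/dvdXnP: dvd2 => -> //; lia.
have bE : b = d - c0 by rewrite /b w00.
(* A and A y are the e_0- and e_1-coordinates of F e_0. *)
exists c0, (b / c0).
have dE : c0 * (1 + b / c0) = d by rewrite mulrDr mulr1 mulrCA divff // mulr1 bE addrC subrK.
have TE' : c0 *: ('X + (b / c0) *: P) = T.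
  by rewrite scalerDr scalerA mulrCA divff // mulr1.
rewrite TE' dE; split=> //.
  by move: d0; rewrite -dE mulf_eq0 negb_or c00.
(* The product [e_0, e_1] is the one that sees delta'. *)
have : F (vec n 0 (P' + delta' *: 'X^(n.-1))) = L_bracket alpha (vec n c0 w0) (vec n 0 w1).
  by rewrite -br01 FM Fe0 Fe1.
rewrite FE comp_polyD comp_polyZ comp_Xn_poly bracket_vec // scale0r add0r subr0 => /vecP[_].
rewrite -/P -/delta -/d => dvd3.
have := dvdXn_lead_exp n.-1 T0; rewrite T1 prednK; last lia.
set E := _ - _ => dvd4.
have : 'X^n %| (c0 * d) *: ((c0 ^+ (n - 2) * delta' - delta) *: 'X^(n.-1)).
  have A1E : c0 ^+ n.-1 = c0 * c0 ^+ (n - 2).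
    by rewrite -exprS; congr (_ ^+ _); lia.
  (* Everything else is divisible by X^n: w0 - w1 supplies X^(n-2) and P supplies X^2, while w1 may
     be replaced by its constant term d in front of X^(n-1). *)
  have -> : (c0 * d) *: ((c0 ^+ (n - 2) * delta' - delta) *: 'X^(n.-1)) =
     w1 * (P' \Po T + delta' *: T ^+ n.-1) - (w0 * (d *: P) + (c0 * d * delta) *: 'X^(n.-1))
     - w1 * (P' \Po T - d *: P) + (w0 - w1) * (d *: P) - (delta' *: w1) * E
     - (w1 - d%:P) * ((delta' * c0 ^+ n.-1) *: 'X^(n.-1)).
    by rewrite /E A1E -!mul_polyC; ring.
  have w1d : 'X %| w1 - d%:P by rewrite dvdX_coef0 coefB coefC subrr.
  have w01 : 'X^n %| (w0 - w1) * P.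
    have -> : n = (n - 2 + 2)%N by lia.
    by rewrite exprD dvdp_mul // dvdX2_structure_poly.
  rewrite -!mul_polyC in dvd1 dvd3 dvd4 *.
  apply: dvdp_sub; last by rewrite mulrCA dvdp_mull // XnE dvdp_mul.
  apply: dvdp_sub; last by rewrite dvdp_mull.
  apply: dvdp_add; last by rewrite mulrCA dvdp_mull.
  by apply: dvdp_sub; rewrite // dvdp_mull.
rewrite dvdpZr ?mulf_neq0 //; move/dvdXnP/(_ n.-1); rewrite coefZ coefXn eqxx mulr1 => E0.
by apply/esym/eqP; rewrite -subr_eq0 E0 //; lia.
Qed.

End Necessity.

End Isomorphisms.

(** * Isomorphism is symmetric and transitive *)

Lemma isomorphic_sym (K : fieldType) (A B : algebra K) :
  isomorphic A B -> isomorphic B A.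
Proof.
move=> [f [[g fK gK] fM]].
pose h : {linear B -> A} :=
  HB.pack g (GRing.isLinear.Build _ _ _ _ g (can2_linear fK gK)).
exists h; split=> [|x y]; first by exists f.
by apply: (can_inj fK); rewrite fM !gK.
Qed.

Lemma isomorphic_trans (K : fieldType) (A B C : algebra K) :
  isomorphic A B -> isomorphic B C -> isomorphic A C.
Proof.
move=> [f [fbij fM]] [g [gbij gM]].
pose h : {linear A -> C} := (g \o f : {linear A -> C}).
by exists h; split=> [|x y]; [exact: bij_comp | rewrite /= fM gM].
Qed.

(** * Normal forms *)

Section Classification.
Variables (K : fieldType) (n : nat).
Hypothesis n4 : (4 <= n)%N.
Implicit Types alpha beta : (n.-1).-tuple K.

Lemma isomorphic_rho alpha beta :
  isomorphic (L beta) (L alpha) <->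
  exists A y : K, [/\ A != 0, 1 + y != 0 &
    forall i, (1 <= i <= n - 1)%N -> at3 beta i.+2 = rho n i A^-1 y (at3 alpha)].
Proof.
split=> [[f [fbij fM]]|[A [y [A0 y1 /transport_rho E]]]]; last first.
  by have [] := E A0 n4; exact: isomorphic_of_transport.
have [A [y [A0 y1 dvdP dE]]] :=
  transport_of_morphism n4 (linearP f) (bij_inj fbij) fM.
by exists A, y; split=> //; apply/transport_rho.
Qed.

(** A = 1 and y = 0 give g = X, the trivial substitution. *)
Lemma rho_id (z : nat -> K) i : (1 <= i <= n - 1)%N -> rho n i 1 0 z = z i.+2.
Proof.
rewrite -[X in rho n i X]invr1 => i_n; apply/esym; move: i i_n.
apply/transport_rho; rewrite ?oner_neq0 // expr1n mul1r; split=> //.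
by rewrite scale0r !addr0 scale1r comp_polyXr mulr1 scale1r subrr dvdp0.
Qed.

Lemma rho1E x y (z : nat -> K) : rho n 1 x y z = x * ((1 + y) * z 3).
Proof.
rewrite /rho (_ : (1 == n.-1)%N = false); last lia.
by rewrite phi_eq big_geq // subr0.
Qed.

Lemma rho2E x y (z : nat -> K) :
  rho n 2 x y z = x ^+ 2 * ((1 + y) * (z 4 - 2 * y * z 3 ^+ 2)).
Proof.
rewrite /rho (_ : (2 == n.-1)%N = false); last lia.
congr (_ * _); rewrite phi_eq big_nat1 phi_eq big_geq // subr0.
(* S_{4,3} = 2 y z_3 is read off as the coefficient of X^3 in (X + y P)^2, avoiding the sum over
   tuples. *)
have := @coef_transported_exp K z 4 3 4 1 y erefl erefl.
rewrite scale1r expr1n mul1r /= => <-.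
rewrite expr2 coefM !big_ord_recl big_ord0 /= !coefD !coefX !coefZ !coef_poly /=.
by rewrite /bump /=; ring.
Qed.

(** rho_2 = 0 is solved by y = alpha_4 / (2 alpha_3^2), and then rho_1 = 1 by x = 1 / ((1 + y)
    alpha_3). *)
Definition x_of alpha : K :=
  2 * at3 alpha 3 / (at3 alpha 4 + 2 * at3 alpha 3 ^+ 2).
Definition y_of alpha : K := at3 alpha 4 / (2 * at3 alpha 3 ^+ 2).

Definition normal_form alpha : (n.-1).-tuple K :=
  [tuple rho n i.+1 (x_of alpha) (y_of alpha) (at3 alpha) | i < n.-1].

Lemma at3_normal_form alpha i : (1 <= i <= n - 1)%N ->
  at3 (normal_form alpha) i.+2 = rho n i (x_of alpha) (y_of alpha) (at3 alpha).
Proof.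
move=> i_n; have lt_i : (i.-1 < n.-1)%N by lia.
rewrite /at3 (_ : (i.+2 - 3)%N = i.-1); last lia.
have := tnth_nth 0 (normal_form alpha) (Ordinal lt_i).
by rewrite tnth_mktuple /= prednK => [<-|]; last lia.
Qed.

Hypothesis char2 : 2 != 0 :> K.

Lemma in_U_neq0 alpha : in_U alpha ->
  [/\ at3 alpha 3 != 0, at3 alpha 4 + 2 * at3 alpha 3 ^+ 2 != 0,
      x_of alpha != 0 & 1 + y_of alpha != 0].
Proof.
rewrite /in_U mulf_eq0 negb_or => /andP[a3 a4]; split=> //.
  by rewrite /x_of !mulf_neq0 ?invr_eq0.
have -> : 1 + y_of alpha = (at3 alpha 4 + 2 * at3 alpha 3 ^+ 2) / (2 * at3 alpha 3 ^+ 2).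
  by rewrite /y_of; field; rewrite a3 char2.
by rewrite !mulf_neq0 ?invr_eq0 ?mulf_neq0 ?expf_neq0.
Qed.

Lemma normal_form3 alpha : in_U alpha -> at3 (normal_form alpha) 3 = 1.
Proof.
move=> /in_U_neq0[a3 a4 _ _]; rewrite at3_normal_form ?rho1E; last lia.
by rewrite /x_of /y_of; field; rewrite a4 a3 char2.
Qed.

Lemma normal_form4 alpha : in_U alpha -> at3 (normal_form alpha) 4 = 0.
Proof.
move=> /in_U_neq0[a3 a4 _ _]; rewrite at3_normal_form ?rho2E; last lia.
by rewrite /x_of /y_of; field; rewrite a4 a3 char2.
Qed.

Lemma normal_form_isomorphic alpha : in_U alpha ->
  isomorphic (L (normal_form alpha)) (L alpha).
Proof.
move=> /in_U_neq0[_ _ x0 y1]; apply/isomorphic_rho.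
exists (x_of alpha)^-1, (y_of alpha); split; rewrite ?invr_eq0 // invrK.
exact: at3_normal_form.
Qed.

(** rho_2 = 0 forces y = 0, because A, 1 + y and 2 are nonzero; then rho_1 = 1 forces A = 1, and the
    substitution is trivial. *)
Lemma isomorphic_normalized alpha beta :
  at3 alpha 3 = 1 -> at3 alpha 4 = 0 -> at3 beta 3 = 1 -> at3 beta 4 = 0 ->
  isomorphic (L beta) (L alpha) -> beta = alpha.
Proof.
move=> a3 a4 b3 b4 /isomorphic_rho[A [y [A0 y1 E]]].
have := E 2%N; rewrite b4 rho2E a3 a4 sub0r expr1n mulr1 => /(_ _)/esym/eqP.
rewrite mulf_eq0 expf_eq0 /= invr_eq0 (negPf A0) mulf_eq0 (negPf y1) /=.
rewrite oppr_eq0 mulf_eq0 (negPf char2) /= => y0.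
have {}y0 : y = 0 by apply/eqP/y0; lia.
have := E 1%N; rewrite b3 rho1E a3 y0 addr0 !mulr1 => A1.
have {}A1 : A^-1 = 1 by rewrite A1 //; lia.
apply/val_inj/(@eq_from_nth _ 0); rewrite ?size_tuple // => j jn.
have j_n : (1 <= j.+1 <= n - 1)%N by lia.
by have := E j.+1 j_n; rewrite y0 A1 rho_id // /at3 !subSS subn0.
Qed.

Lemma isomorphic_iff_normal_form alpha beta : in_U alpha -> in_U beta ->
  isomorphic (L alpha) (L beta) <-> normal_form alpha = normal_form beta.
Proof.
move=> Ua Ub; have isoa := normal_form_isomorphic Ua.
have isob := normal_form_isomorphic Ub; split=> [isoab|E].
  apply: isomorphic_normalized; rewrite ?normal_form3 ?normal_form4 //.
  by apply: isomorphic_trans isoa _; apply: isomorphic_trans isoab (isomorphic_sym isob).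
by apply: isomorphic_trans (isomorphic_sym isoa) _; rewrite E.
Qed.

(** The first two entries of a normal form are always 1 and 0, so only the indices i >= 3 carry
    information. *)
Lemma normal_form_eq alpha beta : in_U alpha -> in_U beta ->
  normal_form alpha = normal_form beta <->
  forall i, (3 <= i <= n - 1)%N ->
    rho n i (x_of alpha) (y_of alpha) (at3 alpha) =
    rho n i (x_of beta) (y_of beta) (at3 beta).
Proof.
move=> Ua Ub; split=> [E i i_n|E].
  by rewrite -!at3_normal_form ?E //; lia.
have at3_eq i : (3 <= i <= n.+1)%N ->
    at3 (normal_form alpha) i = at3 (normal_form beta) i.
  move=> i_n; have [->|i3] := eqVneq i 3%N; first by rewrite !normal_form3.
  have [->|i4] := eqVneq i 4%N; first by rewrite !normal_form4.
  have -> : i = i.-2.+2 by lia.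
  by rewrite !at3_normal_form ?E //; lia.
apply/val_inj/(@eq_from_nth _ 0); rewrite ?size_tuple // => j jn.
by have := at3_eq j.+3; rewrite /at3 !subSS subn0; apply; lia.
Qed.

Lemma rho_surjective (a : (n - 3).-tuple K) : exists alpha,
  in_U alpha /\ forall i, (3 <= i <= n - 1)%N ->
    rho n i (x_of alpha) (y_of alpha) (at3 alpha) = at3 a i.
Proof.
(* The tuple (1, 0, a_3, ..., a_{n-1}) is its own normal form: it has x = 1 and y = 0. *)
have sz : size (1 :: 0 :: a : seq K) == n.-1 by rewrite /= size_tuple; lia.
exists (Tuple sz).
have a3 : at3 (Tuple sz) 3 = 1 by [].
have a4 : at3 (Tuple sz) 4 = 0 by [].
split; first by rewrite /in_U a3 a4 expr1n add0r mulr1 mul1r.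
move=> i i_n; rewrite /x_of /y_of a3 a4 expr1n add0r !mulr1 divff // mul0r.
rewrite rho_id; last lia.
by rewrite /at3 (_ : (i.+2 - 3)%N = (i - 3).+2) //; lia.
Qed.

End Classification.

Theorem theorem3 (R : realType) (n : nat) (hn : (4 <= n)%N) :
  (forall alpha alpha' : (n.-1).-tuple R[i],
     in_U alpha -> in_U alpha' ->
     (isomorphic (L alpha) (L alpha') <->
      forall i : nat, (3 <= i <= n - 1)%N ->
        rho n i
          (2 * at3 alpha 3 / (at3 alpha 4 + 2 * at3 alpha 3 ^+ 2))
          (at3 alpha 4 / (2 * at3 alpha 3 ^+ 2))
          (at3 alpha)
        = rho n i
          (2 * at3 alpha' 3 / (at3 alpha' 4 + 2 * at3 alpha' 3 ^+ 2))
          (at3 alpha' 4 / (2 * at3 alpha' 3 ^+ 2))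
          (at3 alpha')))
  /\
  (forall a : (n - 3).-tuple R[i],
     exists alpha : (n.-1).-tuple R[i],
       in_U alpha /\
       forall i : nat, (3 <= i <= n - 1)%N ->
         rho n i
           (2 * at3 alpha 3 / (at3 alpha 4 + 2 * at3 alpha 3 ^+ 2))
           (at3 alpha 4 / (2 * at3 alpha 3 ^+ 2))
           (at3 alpha)
         = at3 a i).
Proof.
have char2 : 2 != 0 :> R[i] by rewrite Num.Theory.pnatr_eq0.
split; last exact: rho_surjective.
move=> alpha alpha' Ua Ua'.
by rewrite (isomorphic_iff_normal_form hn char2 Ua Ua') normal_form_eq.
Qed.
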